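(* Let $\Gamma$ be a connected graph with infinite set of vertices $\mathcal{V}$ and path metric $d$ on $\mathcal{V}$. Let $v_{0}\in\mathcal{V}$ and, for $n\in\omega$, let $S(v_{0},n)=\{v\in\mathcal{V}: d(v_{0},v)=n\}$, and let $\Gamma_{n}$ be the (induced) subgraph of $\Gamma$ with the set of vertices $S(v_{0},n)\cup S(v_{0},n+1)$. Assume that there exists $k\in\mathbb{N}$ such that, for every $n\in\omega$, each connected component of $\Gamma_{n}$ is contained in some ball $\{u\in\mathcal{V}: d(v,u)\le k\}$, $v\in\mathcal{V}$, of radius $k$ in $\Gamma$. Then the coarse structure $\mathcal{E}_{\Gamma}$ is $\vee$-decomposable.
   Context: A coarse structure on a set $X$ is a family $\mathcal{E}$ of subsets of $X\times X$ such that: each $\varepsilon\in\mathcal{E}$ contains the diagonal $\Delta_X=\{(x,x):x\in X\}$; if $\varepsilon,\delta\in\mathcal{E}$ then $\varepsilon\circ\delta=\{(x,y):\exists z\,((x,z)\in\varepsilon,(z,y)\in\delta)\}\in\mathcal{E}$ and $\varepsilon^{-1}=\{(y,x):(x,y)\in\varepsilon\}\in\mathcal{E}$; if $\varepsilon\in\mathcal{E}$ and $\Delta_X\subseteq\varepsilon'\subseteq\varepsilon$ then $\varepsilon'\in\mathcal{E}$. Put $B(x,\varepsilon)=\{y\in X:(x,y)\in\varepsilon\}$. Only connected coarse structures on infinite sets are considered: for any $x,y\in X$ there is $\varepsilon\in\mathcal{E}$ with $y\in B(x,\varepsilon)$. A subset $\mathcal{E}'\subseteq\mathcal{E}$ is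 a base of $\mathcal{E}$ if every $\varepsilon\in\mathcal{E}$ is contained in some $\varepsilon'\in\mathcal{E}'$. $\mathcal{E}_0\vee\mathcal{E}_1$ is the smallest (by inclusion) coarse structure on $X$ containing both $\mathcal{E}_0$ and $\mathcal{E}_1$. A coarse structure is cellular if it has a base consisting of equivalence relations. A coarse structure $\mathcal{E}$ on $X$ is $\vee$-decomposable if there exist two cellular coarse structures $\mathcal{E}_0,\mathcal{E}_1$ on $X$ with $\mathcal{E}=\mathcal{E}_0\vee\mathcal{E}_1$. For a metric $d$ on $X$, $\mathcal{E}_d$ is the coarse structure with base $\{(x,y)\in X\times X:d(x,y)\le n\}$, $n\in\omega$. For a connected graph $\Gamma$ with vertex set $\mathcal{V}$ and path metric $d$ on $\mathcal{V}$, $\mathcal{E}_\Gamma$ denotes the coarse structure $\mathcal{E}_d$ on $\mathcal{V}$. *)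

(* Defs.v *)
From mathcomp Require Import all_boot.
From mathcomp Require Import boolp classical_sets functions cardinality.

Set Implicit Arguments.
Unset Strict Implicit.
Unset Printing Implicit Defensive.

Local Open Scope classical_set_scope.
Local Open Scope relation_scope.

Section Coarse.
Variable X : Type.
Implicit Types (E : set (set (X * X))) (e : set (X * X)).

(* The relational composite {(x,y) | exists z, (x,z) in e /\ (z,y) in f} is
   written [f \; e] in relation_scope. As only connected coarse structures are
   considered, connectedness is part of the definition. *)
Definition coarse_structure E : Prop :=
  [/\ forall e, E e -> diagonal `<=` e,
      forall e f, E e -> E f -> E (f \; e),
      forall e, E e -> E (e^-1),
      forall e e', E e -> diagonal `<=` e' -> e' `<=` e -> E e' &
      forall x y, exists2 e, E e & e (x, y)].

Definition coarse_base (B E : set (set (X * X))) : Prop :=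
  B `<=` E /\ forall e, E e -> exists2 e', B e' & e `<=` e'.

Definition equivalence_relation e : Prop :=
  RelationClasses.Equivalence (fun x y => e (x, y)).

Definition cellular E : Prop :=
  exists2 B, coarse_base B E & forall e, B e -> equivalence_relation e.

(* See [coarse_joinP] for the fact that this intersection is the least coarse
   structure containing both arguments. *)
Definition coarse_join E0 E1 : set (set (X * X)) :=
  smallest coarse_structure (E0 `|` E1).

Definition join_decomposable E : Prop :=
  exists E0 E1, [/\ coarse_structure E0, cellular E0,
                    coarse_structure E1, cellular E1 & E = coarse_join E0 E1].

Definition band (d : X -> X -> nat) (n : nat) : set (X * X) :=
  [set p | d p.1 p.2 <= n].

(* The metrics needed here are path metrics, hence take values in [nat]. *)
Definition metric_coarse (d : X -> X -> nat) : set (set (X * X)) :=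
  [set e | diagonal `<=` e /\ exists n, e `<=` band d n].

Lemma coarse_joinP E0 E1 : coarse_structure E0 -> coarse_structure E1 ->
  [/\ coarse_structure (coarse_join E0 E1),
      E0 `<=` coarse_join E0 E1, E1 `<=` coarse_join E0 E1 &
      forall E, coarse_structure E -> E0 `<=` E -> E1 `<=` E ->
        coarse_join E0 E1 `<=` E].
Proof.
move=> [r0 _ _ _ c0] [r1 _ _ _ _].
have coarse_all : coarse_structure [set e | diagonal `<=` e].
  split=> //=.
  - by move=> e f re rf [x y] xy; exists x; [exact: re|exact: rf].
  - by move=> e re [x y] /= xy; exact: re.
  - by move=> x y; exists setT.
split.
- split.
  + by move=> e; apply; split=> // e' [/r0|/r1].
  + by move=> e f He Hf E HE; case: (HE.1) => _ + _ _ _; apply; [exact: He|exact: Hf].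
  + by move=> e He E HE; case: (HE.1) => _ _ + _ _; apply; exact: He.
  + move=> e e' He re' se E HE; case: (HE.1) => _ _ _ + _; apply; [exact: He| |] => //.
  + by move=> x y; have [e E0e exy] := c0 x y; exists e => // E [_]; apply; left.
- by move=> e Ee E [_]; apply; left.
- by move=> e Ee E [_]; apply; right.
- by move=> E cE s0 s1 e; apply; split=> // e' [/s0|/s1].
Qed.

Lemma metric_coarseP (d : X -> X -> nat) :
  (forall x y, d x y = 0 <-> x = y) -> (forall x y, d x y = d y x) ->
  (forall x y z, d x z <= d x y + d y z) ->
  coarse_structure (metric_coarse d) /\
  coarse_base (range (band d)) (metric_coarse d).
Proof.
move=> d0 dC dT; have rb n : diagonal `<=` band d n.
  by move=> [x y] /= /d0 xy; rewrite /band /= xy.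
split; split.
- by move=> e [].
- move=> e f [re [m em]] [rf [n fn]]; split.
    by move=> [x y] xy; exists x; [exact: re|exact: rf].
  exists (m + n) => -[x y] [z /em /= xz /fn /= zy].
  exact: leq_trans (dT x z y) (leq_add xz zy).
- move=> e [re [n en]]; split; first by move=> [x y] /= xy; exact: re.
  by exists n => -[x y] /en /=; rewrite /band /= dC.
- by move=> e e' [_ [n en]] re' se; split=> //; exists n => p /se /en.
- by move=> x y; exists (band d (d x y)); [split=> //; exists (d x y)|rewrite /band /=].
- by move=> _ [n _ <-]; split=> //; exists n.
- by move=> e [_ [n en]]; exists (band d n) => //; exists n.
Qed.

End Coarse.

Section Graph.
Variable V : Type.
Implicit Types (g : rel V) (x y : V) (A : set V) (n : nat).

Definition simple_graph g : Prop := symmetric g /\ irreflexive g.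

Definition walk g n x y : Prop :=
  exists p : seq V, [/\ path g x p, last x p = y & size p = n].

Definition joined g x y : Prop := exists n, walk g n x y.

Definition connected_graph g : Prop := forall x y, joined g x y.

Lemma joined_asbool g x y : joined g x y -> exists n, `[< walk g n x y >].
Proof. by move=> [n xy]; exists n; exact/asboolP. Qed.

(* The least length of a walk; the value 0 between vertices that are not joined
   is junk. *)
Definition path_dist g x y : nat :=
  if pselect (joined g x y) is left xy then ex_minn (joined_asbool xy) else 0.

Definition graph_coarse g : set (set (V * V)) := metric_coarse (path_dist g).

Definition graph_ball g x n : set V := [set y | path_dist g x y <= n].

Definition graph_sphere g x n : set V := [set y | path_dist g x y = n].

(* The induced subgraph on [A] keeps [V] as carrier: vertices outside [A] are
   isolated, and [components] only looks at vertices in [A]. *)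
Definition induced g A : rel V := fun x y => [&& x \in A, y \in A & g x y].

Definition components g A : set (set V) :=
  [set [set y | joined (induced g A) x y] | x in A].

Lemma path_distP g x y : joined g x y ->
  walk g (path_dist g x y) x y /\ forall n, walk g n x y -> path_dist g x y <= n.
Proof.
rewrite /path_dist; case: pselect => // xy _.
by case: ex_minnP => m /asboolP mxy mmin; split=> // n nxy; apply/mmin/asboolP.
Qed.

Lemma graph_coarseP g : simple_graph g -> connected_graph g ->
  coarse_structure (graph_coarse g) /\
  coarse_base (range (band (path_dist g))) (graph_coarse g).
Proof.
move=> [gC _] gcon; have P x y := path_distP (gcon x y).
have W x y : walk g (path_dist g y x) x y.
  have [[p [pp <- <-]] _] := P y x.
  exists (rev (belast y p)); split; last by rewrite size_rev size_belast.
    by rewrite rev_path (eq_path (e' := g)) // => a b; rewrite gC.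
  by case: p {pp} => //= a p; rewrite rev_cons last_rcons.
apply: metric_coarseP.
- move=> x y; split=> [d0|->]; last first.
    by apply/eqP; rewrite -leqn0; apply: (P y y).2; exists [::].
  have [[p [_ yE]]] := P x y; rewrite d0 => /size0nil p0.
    by rewrite -yE p0.
- move=> x y; apply/eqP; rewrite eqn_leq; apply/andP.
  by split; apply: (P _ _).2; exact: W.
- move=> x y z; apply: (P _ _).2.
  have [[p [pp py <-]] _] := P x y; have [[q [pq qz <-]] _] := P y z.
  by exists (p ++ q); rewrite cat_path last_cat size_cat py pp.
Qed.

Lemma component_sub g A C : components g A C -> C `<=` A.
Proof.
move=> [x Ax <-] _ [_ [p [pp <- _]]].
by elim: p x Ax pp => //= z p IH x _ /andP[/and3P[_ /set_mem Az _]]; exact: IH.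
Qed.

End Graph.

(* Main.v *)
Require Import Defs.
From mathcomp Require Import all_boot.
From mathcomp Require Import boolp classical_sets functions cardinality.
From mathcomp Require Import zify.

(** Split [V] into the levels [{v | (d(v0,v) + i)./2 = j}], for [i = 0, 1].
    The components of a level lie in balls of radius [k], and every edge lies
    inside a level for [i = 0] or for [i = 1].  Hence the two partitions of [V]
    into components of levels are equivalence relations which together generate
    the coarse structure of the graph.  A single partition does not generate a
    connected coarse structure, so for every [n] also allow all levels of index
    at most [n] to be merged into one class: this is still an equivalence, as
    their union is bounded and saturated. *)

Local Open Scope classical_set_scope.
Local Open Scope relation_scope.

Definition generated_by {X : Type} (F : nat -> set (X * X)) :
    set (set (X * X)) :=
  [set e | diagonal `<=` e /\ exists n, e `<=` F n].

(** Composites stay in the family because [F m] and [F n] both lie in [F (maxn m n)], which is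
    transitive. The [F n] themselves form the base of equivalences. *)
Lemma generated_by_cellular {X : Type} (F : nat -> set (X * X)) :
    (forall n, equivalence_relation (F n)) ->
    (forall m n, m <= n -> F m `<=` F n) ->
    (forall x y, exists n, F n (x, y)) ->
  coarse_structure (generated_by F) /\ cellular (generated_by F).
Proof.
move=> Feq Fmono Fcover.
have Frefl n : diagonal `<=` F n.
  by move=> [x y]; rewrite /diagonal /= => ->; case: (Feq n).
split; first split.
- by move=> e [].
- move=> e f [re [m em]] [rf [n fn]]; split.
    by move=> [x y] xy; exists x; [exact: re|exact: rf].
  exists (maxn m n) => -[x y] [z /em xz /fn zy].
  have [_ _ Ftrans] := Feq (maxn m n); apply: (Ftrans x z y).
    exact: Fmono (leq_maxl m n) _ xz.
  exact: Fmono (leq_maxr m n) _ zy.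
- move=> e [re [n en]]; split; first by move=> [x y] /= xy; exact: re.
  by exists n => -[x y] /en; have [_ Fsym _] := Feq n; exact: Fsym.
- by move=> e e' [_ [n en]] re' se; split=> //; exists n => p /se /en.
- by move=> x y; have [n nxy] := Fcover x y; exists (F n) => //; split=> //; exists n.
- exists (range F); last by move=> _ [n _ <-]; exact: Feq.
  split=> [_ [n _ <-]|e [_ [n en]]]; first by split=> //; exists n.
  by exists (F n) => //; exists n.
Qed.

Lemma joined_equivalence {V : Type} {h : rel V} :
  symmetric h -> RelationClasses.Equivalence (joined h).
Proof.
move=> hC; split.
- by move=> x; exists 0, [::].
- move=> x y [n [p [pp <- _]]]; exists (size p), (rev (belast x p)).
  rewrite size_rev size_belast; split=> //.
    by rewrite rev_path (eq_path (e' := h)) // => a b; rewrite hC.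
  by case: p {pp} => //= a p; rewrite rev_cons last_rcons.
- move=> x y z [m [p [pp py _]]] [n [q [pq qz _]]].
  by exists (size (p ++ q)), (p ++ q); rewrite cat_path last_cat py pp.
Qed.

Lemma path_dist_step {V : Type} (g : rel V) (v x y : V) :
  connected_graph g -> g x y -> path_dist g v y <= (path_dist g v x).+1.
Proof.
move=> gcon gxy; have [[p [pp px <-]] _] := path_distP (gcon v x).
apply: (path_distP (gcon v y)).2; exists (rcons p y).
by rewrite rcons_path last_rcons size_rcons pp px.
Qed.

Section Levels.
Context {V : Type} (g : rel V) (l : V -> nat).

Definition level_graph : rel V := fun x y => g x y && (l x == l y).

Definition merge_levels (n : nat) : set (V * V) :=
  [set p | joined level_graph p.1 p.2 \/ l p.1 <= n /\ l p.2 <= n].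

Lemma joined_level x y : joined level_graph x y -> l x = l y.
Proof.
move=> [_ [p [pp <- _]]]; elim: p x pp => //= z p IH x /andP[/andP[_ /eqP ->]].
exact: IH.
Qed.

(** A walk in [level_graph] never leaves the level of its start, hence stays in [A]. This gives
    access to the hypothesis on components of induced subgraphs. *)
Lemma joined_level_induced (A : set V) x y :
    (forall z, l z = l x -> A z) ->
  joined level_graph x y -> joined (induced g A) x y.
Proof.
move=> + [n [p [pp py pn]]] => lA; exists n, p; split=> //.
elim: p x lA pp {py pn} => //= z p IH x lA /andP[/andP[gxz /eqP xz] pp].
rewrite IH //; last by move=> w wz; apply: lA; rewrite wz.
by rewrite /induced gxz !mem_set //; apply: lA.
Qed.

Lemma merge_levels_cellular : symmetric g ->
  coarse_structure (generated_by merge_levels) /\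
  cellular (generated_by merge_levels).
Proof.
move=> gC; have hC : symmetric level_graph.
  by move=> x y; rewrite /level_graph gC eq_sym.
have [Jrefl Jsym Jtrans] := joined_equivalence hC.
apply: generated_by_cellular.
- move=> n; split.
  + by move=> x; left; exact: Jrefl.
  + by move=> x y [/Jsym|[? ?]]; [left|right].
  (* The mixed cases hold since [l] is constant along walks of [level_graph]: a component meeting
     the merged levels lies inside them. *)
  + move=> x y z [xy|[/= xn yn]] [yz|[/= yn' zn]]; rewrite /merge_levels /=.
    * by left; exact: Jtrans xy yz.
    * by right; rewrite (joined_level _ _ xy).
    * by right; rewrite -(joined_level _ _ yz).
    * by right.
- move=> m n mn [x y] [/= xy|/= [xm ym]]; [by left|right].
  by split; [exact: leq_trans xm mn|exact: leq_trans ym mn].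
- by move=> x y; exists (maxn (l x) (l y)); right; rewrite leq_maxl leq_maxr.
Qed.

End Levels.

(** Composing [f] with itself often enough yields one member of [E] that contains all walks of
    length at most [n]; the diagonal absorbs the shorter ones. *)
Lemma graph_coarse_min {V : Type} (g : rel V) (E : set (set (V * V))) (f : set (V * V)) :
    connected_graph g -> coarse_structure E -> E f ->
    (forall x y, g x y -> f (x, y)) ->
  graph_coarse g `<=` E.
Proof.
move=> gcon [Erefl Ecomp _ Esub _] Ef gf e [re [n en]].
suff [f' Ef' ff'] : exists2 f', E f' & band (path_dist g) n `<=` f'.
  by apply: Esub Ef' re _ => p /en /ff'.
have [f' Ef' walkf'] : exists2 f', E f' &
    forall p x, path g x p -> size p <= n -> f' (x, last x p).
  elim: n {en} => [|n [f' Ef' walkf']].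
    by exists f => // -[|//] x _ _ /=; apply: (Erefl f Ef (x, x)).
  exists (f' \; f); first exact: Ecomp.
  move=> [|z p] x /=.
    by move=> _ _; exists x; [exact: (Erefl f Ef (x, x))|exact: (Erefl f' Ef' (x, x))].
  by move=> /andP[gxz pp] sp; exists z; [exact: gf|exact: walkf'].
exists f' => // -[x y] /=; rewrite /band /=.
by have [[p [pp <- <-]] _] := path_distP (gcon x y) => /(walkf' _ _ pp).
Qed.

Theorem proposition9 (V : Type) (g : rel V) (v0 : V)
  (g_simple : simple_graph g) (g_connected : connected_graph g)
  (V_infinite : infinite_set [set: V])
  (small_components : exists k : nat, forall (n : nat) (C : set V),
    components g (graph_sphere g v0 n `|` graph_sphere g v0 n.+1) C ->
    exists v : V, C `<=` graph_ball g v k) :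
  join_decomposable (graph_coarse g).
Proof.
have gC := g_simple.1; have [k small] := small_components.
have [gcoarse [gband _]] := graph_coarseP g_simple g_connected.
pose l i x := (path_dist g v0 x + i)./2.
pose E i := generated_by (merge_levels g (l i)).
have cellE i : coarse_structure (E i) /\ cellular (E i).
  exact: merge_levels_cellular.
have Esub i : i <= 1 -> E i `<=` graph_coarse g.
  move=> i1 e [re [n en]].
  have [_ Gcomp Ginv Gsub _] := gcoarse.
  (* Related points share a ball: of radius [k] around some [v] in the unmerged case, around [v0] in
     the merged one, where [(d + i)./2 <= n] gives [d <= n.*2.+1]. The composite of [b^-1] and [b]
     passes through the centre. *)
  pose b := band (path_dist g) (maxn k n.*2.+1).
  have Gb : graph_coarse g b by apply: gband; exists (maxn k n.*2.+1).
  apply: Gsub (Gcomp _ _ (Ginv _ Gb) Gb) re _ => -[x y] /en [/= xy|/= [xn yn]].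
    (* For [i = 1] and level [0] the truncated subtraction gives [m = 0], and
       the level [{v0}] is still contained in [A]. *)
    pose m := (l i x).*2 - i.
    pose A := graph_sphere g v0 m `|` graph_sphere g v0 m.+1.
    (* Level [j] consists of the distances [d] with [2j - i <= d <= 2j - i + 1]. *)
    have lA z : l i z = l i x -> A z.
      by rewrite /A /graph_sphere /= /m /l; lia.
    have [|v vC] := small m [set z | joined (induced g A) x z].
      by exists x => //; exact: lA.
    have vx : graph_ball g v k x by apply: vC; exists 0, [::].
    have vy : graph_ball g v k y by apply: vC; exact: joined_level_induced xy.
    by exists v; rewrite /b /band /= leq_max ?vx ?vy.
  by exists v0; move: xn yn; rewrite /b /band /l /=; lia.
have [c0 cell0] := cellE 0; have [c1 cell1] := cellE 1.
exists (E 0), (E 1); split=> //.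
have [cJ J0 J1 Jmin] := coarse_joinP c0 c1.
apply/seteqP; split; last by apply: Jmin => //; exact: Esub.
have Erefl i n : diagonal `<=` merge_levels g (l i) n.
  by move=> [x y]; rewrite /diagonal /= => ->; left; exists 0, [::].
have EF i : E i (merge_levels g (l i) 0) by split=> //; exists 0.
have [_ Jcomp _ _ _] := cJ.
(* This composite contains every edge: one factor carries the edge, the other a diagonal pair. *)
have Jedge := Jcomp _ _ (J0 _ (EF 0)) (J1 _ (EF 1)).
apply: (graph_coarse_min _ _ _ g_connected cJ Jedge).
move=> x y gxy.
have edge i : l i x = l i y -> merge_levels g (l i) 0 (x, y).
  by move=> xy; left; exists 1, [:: y]; rewrite /= /level_graph gxy xy eqxx.
(* Adjacent vertices have distances to [v0] differing by at most 1. Of two consecutive numbers, the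
   halves agree for [i = 0] if the smaller is even, for [i = 1] if it is odd. *)
have [xy|xy] : l 0 x = l 0 y \/ l 1 x = l 1 y.
  have := path_dist_step _ v0 _ _ g_connected gxy.
  have gyx : g y x by rewrite gC.
  by have := path_dist_step _ v0 _ _ g_connected gyx; rewrite /l; lia.
- by exists y; [exact: edge|exact: Erefl].
- by exists x; [exact: Erefl|exact: edge].
Qed.
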